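(* Let $A$ be any allocator and $\gamma$ a positive integer. Then, starting from the empty system, there is a sequence of $2^{2\gamma-1}$ insertions of unit tasks such that the current instance is $\gamma$-underallocated after every insertion, but $A$ makes at least one reallocation during the sequence.
   Context: Single processor, unit-length tasks, windows are closed real intervals of arbitrary lengths. A slot is a closed interval of length $1$; intervals overlap iff their interiors intersect. A solution of an instance assigns each task a slot inside its window with no two slots overlapping. For $\gamma\ge1$ an instance is $\gamma$-underallocated iff one can assign each task an interval of length $\gamma$ inside its window with pairwise non-overlapping intervals. An allocator processes a sequence of insertions and deletions and must maintain a solution for the current instance after every insertion whose resulting instance has a solution; a reallocation is a change of the slot of a task already present before the operation. *)

(* Defs.v *)
From HB Require Import structures.
From mathcomp Require Import all_boot all_order all_algebra finmap.
From mathcomp Require Import all_classical all_reals topology normedtype.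

Set Implicit Arguments.
Unset Strict Implicit.
Unset Printing Implicit Defensive.

Import Order.TTheory GRing.Theory Num.Theory.
Import numFieldNormedType.Exports.

Local Open Scope fset_scope.
Local Open Scope fmap_scope.
Local Open Scope classical_set_scope.
Local Open Scope ring_scope.

Record window (R : realType) := Window {
  win_lo : R;
  win_hi : R;
  win_le : win_lo <= win_hi
}.

Definition window_set (R : realType) (w : window R) : set R :=
  `[win_lo w, win_hi w].

(* The closed interval of length l with left endpoint x. Intervals of a known
   length, in particular slots (l = 1), are represented by left endpoints. *)
Definition interval_at (R : realType) (l x : R) : set R := `[x, x + l].

Definition overlap (R : realType) (X Y : set R) : Prop :=
  (interior X `&` interior Y) !=set0.

(* Tasks are named by natural numbers, so that distinct tasks may have equal
   windows; an instance maps each of its tasks to its window. *)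
Definition instance (R : realType) := {fmap nat -> window R}.

Definition assignment (R : realType) := {fmap nat -> R}.

Definition packing (R : realType) (l : R) (I : instance R)
    (sigma : assignment R) : Prop :=
  [/\ domf sigma = domf I,
      forall (i : nat) (w : window R) (x : R),
        I.[? i] = Some w -> sigma.[? i] = Some x ->
        interval_at l x `<=` window_set w
    & forall (i j : nat) (x y : R),
        i <> j -> sigma.[? i] = Some x -> sigma.[? j] = Some y ->
        ~ overlap (interval_at l x) (interval_at l y)].

Definition solution (R : realType) (I : instance R) (sigma : assignment R) :
  Prop := packing 1 I sigma.

Definition underallocated (R : realType) (gamma : R) (I : instance R) : Prop :=
  exists sigma : assignment R, packing gamma I sigma.

Inductive request (R : realType) :=
  | Insert of nat & window R
  | Delete of nat.
Arguments Delete {R} _.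

Definition is_insertion (R : realType) (q : request R) : bool :=
  if q is Insert _ _ then true else false.

Definition step (R : realType) (I : instance R) (q : request R) : instance R :=
  match q with
  | Insert i w => I.[i <- w]
  | Delete i => I.[~ i]
  end.

Definition legal_request (R : realType) (I : instance R) (q : request R) :
    bool :=
  match q with
  | Insert i _ => i \notin domf I
  | Delete i => i \in domf I
  end.

Definition current (R : realType) (h : seq (request R)) : instance R :=
  foldl (@step R) [fmap] h.

Definition legal (R : realType) (h : seq (request R)) : Prop :=
  forall (h1 h2 : seq (request R)) (q : request R),
    h = h1 ++ q :: h2 -> legal_request (current h1) q.

(* [A h] is the assignment held after processing the requests [h], oldest
   first, so the allocator is online but may use the whole history. After a
   deletion, or when the instance has no solution, [A h] is arbitrary and may
   leave tasks without a slot. *)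
Definition allocator (R : realType) (A : seq (request R) -> assignment R) :
    Prop :=
  forall (h : seq (request R)) (i : nat) (w : window R),
    legal (rcons h (Insert i w)) ->
    (exists sigma, solution (current (rcons h (Insert i w))) sigma) ->
    solution (current (rcons h (Insert i w))) (A (rcons h (Insert i w))).

(* Processing [q] after [h] changes the slot of task [i]; a task removed by
   [q] itself is not reallocated. *)
Definition reallocates (R : realType) (A : seq (request R) -> assignment R)
    (h : seq (request R)) (q : request R) (i : nat) : Prop :=
  [/\ i \in domf (current h), i \in domf (current (rcons h q))
    & exists x y : R,
        [/\ (A h).[? i] = Some x, (A (rcons h q)).[? i] = Some y & x <> y]].

(* Main.v *)
(** The adversary halves a window of length [gamma * 2 ^ (2 * gamma - 1)].
    Whenever the window has length [gamma * 2 ^ k], it inserts [2 ^ (k - 1)]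
    tasks with that window and passes to the half in which the slots of the
    allocator occupy more space; the other half has room for the new tasks with
    length [gamma] each. If no task is ever reallocated, every round raises the
    occupied fraction of the current window by [1 / (2 * gamma)], so that the
    last window, of length [gamma], is occupied up to length [gamma - 1 / 2]
    and the task inserted there last does not fit. *)

Require Import Defs.
From mathcomp Require Import all_boot all_order all_algebra finmap.
From mathcomp Require Import all_classical all_reals topology normedtype.
From mathcomp Require Import zify lra ring.

Import Order.TTheory GRing.Theory Num.Theory.
Local Open Scope ring_scope.

(** * Intervals of equal length, compared by left endpoints *)

Definition separated {R : realType} (l x y : R) : bool :=
  (x + l <= y) || (y + l <= x).

Lemma separatedC {R : realType} (l x y : R) :
  separated l x y = separated l y x.
Proof. by rewrite /separated orbC. Qed.

Lemma not_overlapE {R : realType} (l x y : R) : 0 < l ->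
  ~ overlap (interval_at l x) (interval_at l y) <-> separated l x y.
Proof.
move=> l0; rewrite /overlap /interval_at /separated !interior_itv.
split=> [nov|sep [z []] /=]; last by rewrite !in_itv /=; lra.
rewrite leNgt [(_ <= x)%R]leNgt -negb_and; apply/negP.
move=> /andP[yx xy]; apply: nov.
(* The midpoint of the common part of both intervals. *)
exists ((Num.max x y + Num.min (x + l) (y + l)) / 2).
split; rewrite /= in_itv /=;
  case: (leP x y) => h1; case: (leP (x + l) (y + l)) => h2; lra.
Qed.

Lemma interval_at_subset {R : realType} (l x : R) (w : window R) : 0 <= l ->
  (interval_at l x `<=` window_set w)%classic <->
  win_lo w <= x /\ x + l <= win_hi w.
Proof.
move=> l0; split=> [sub|[lo hi] z]; last first.
  by rewrite /window_set /interval_at /= !in_itv /=; lra.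
have xI : interval_at l x x by rewrite /interval_at /= in_itv /=; lra.
have xlI : interval_at l x (x + l) by rewrite /interval_at /= in_itv /=; lra.
by move: (sub _ xI) (sub _ xlI); rewrite /window_set /= !in_itv /=; lra.
Qed.

(** * Sequences of insertions as lists of windows *)

(** Counterpart of [packing] for tasks named by their index in [ws]. The function [pos] is total;
    its values from [size ws] on do not matter. *)
Definition fits {R : realType} (l : R) (ws : seq (window R)) (pos : nat -> R) :
    Prop :=
  (forall i w, onth ws i = Some w ->
     win_lo w <= pos i /\ pos i + l <= win_hi w) /\
  (forall i j, (i < size ws)%N -> (j < size ws)%N -> i <> j ->
     separated l (pos i) (pos j)).

Lemma fits_le {R : realType} (l l' : R) ws pos :
  l' <= l -> fits l ws pos -> fits l' ws pos.
Proof.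
move=> ll [win sep].
split=> [i w /win|i j iws jws /(sep i j iws jws)]; first by lra.
by rewrite /separated; lra.
Qed.

Lemma fits_catl {R : realType} (l : R) ws1 ws2 pos :
  fits l (ws1 ++ ws2) pos -> fits l ws1 pos.
Proof.
move=> [win sep]; split=> [i w wi|i j iws jws ij].
  apply: win; rewrite onth_cat -onthTE wi //.
by apply: sep => //; rewrite size_cat ltn_addr.
Qed.

Lemma fits_take {R : realType} (l : R) n ws pos :
  fits l ws pos -> fits l (take n ws) pos.
Proof. by rewrite -{1}(cat_take_drop n ws) => /fits_catl. Qed.

(* The task inserted by the [i]-th request is named [i], counting from 0. *)
Definition requests {R : realType} (ws : seq (window R)) : seq (request R) :=
  foldl (fun h w => rcons h (Insert (size h) w)) [::] ws.

Lemma size_requests {R : realType} (ws : seq (window R)) :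
  size (requests ws) = size ws.
Proof.
elim/last_ind: ws => // ws w IH.
by rewrite /requests foldl_rcons -/(requests ws) !size_rcons IH.
Qed.

Lemma requests_rcons {R : realType} (ws : seq (window R)) w :
  requests (rcons ws w) = rcons (requests ws) (Insert (size ws) w).
Proof. by rewrite /requests foldl_rcons -/(requests ws) size_requests. Qed.

Lemma all_insertion_requests {R : realType} (ws : seq (window R)) :
  all (@is_insertion R) (requests ws).
Proof.
by elim/last_ind: ws => // ws w IH; rewrite requests_rcons all_rcons.
Qed.

Lemma take_requests {R : realType} n (ws : seq (window R)) :
  take n (requests ws) = requests (take n ws).
Proof.
elim/last_ind: ws => [|ws w IH]; first by case: n.
have [ltn|len] := ltnP (size ws) n.
  by rewrite !take_oversize ?size_requests ?size_rcons.
by rewrite requests_rcons -!cats1 !takel_cat ?size_requests.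
Qed.

Lemma current_requests {R : realType} (ws : seq (window R)) i :
  ((current (requests ws)).[? i])%fmap = onth ws i.
Proof.
elim/last_ind: ws => [|ws w IH]; first by rewrite onth0n fnd_fmap0.
rewrite requests_rcons /current foldl_rcons /= -/(current _) fnd_set IH.
rewrite -cats1 onth_cat; case: ltngtP => [||->]; last by rewrite subnn.
  by [].
by move=> iws; rewrite !onth_default //= ?subn_gt0 // ltnW.
Qed.

Lemma mem_current_requests {R : realType} (ws : seq (window R)) i :
  (i \in domf (current (requests ws))) = (i < size ws)%N.
Proof. by rewrite -fndSome current_requests onthTE. Qed.

Lemma legal_requests {R : realType} (ws : seq (window R)) : legal (requests ws).
Proof.
move=> h1 h2 q e.
have: rcons h1 q = requests (take (size h1).+1 ws).
  by rewrite -take_requests e -cat_rcons take_size_cat ?size_rcons.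
case/lastP: (take _ ws) => [/(congr1 size)|ws' w].
  by rewrite size_rcons.
rewrite requests_rcons => /rcons_inj[-> ->] /=.
by rewrite mem_current_requests ltnn.
Qed.

Lemma fits_packing {R : realType} (l : R) ws pos : 0 < l -> fits l ws pos ->
  exists sigma, packing l (current (requests ws)) sigma.
Proof.
move=> l0 [win sep]; set I := current _.
pose sigma : assignment R := [fmap i : domf I => pos (val i)]%fmap.
have sigmaE i x : (sigma.[? i] = Some x)%fmap -> (i < size ws)%N /\ pos i = x.
  case: fndP => // iI; rewrite ffunE /= => -[<-].
  by rewrite -mem_current_requests.
exists sigma; split=> // [i w x|i j x y ij].
  rewrite current_requests => /win[lo hi] /sigmaE[_ <-].
  by apply/interval_at_subset => //; exact: ltW.
by move=> /sigmaE[iws <-] /sigmaE[jws <-]; apply/not_overlapE => //; exact: sep.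
Qed.

Lemma packing_fits {R : realType} (l : R) ws sigma : 0 < l ->
  packing l (current (requests ws)) sigma ->
  fits l ws (fun i => odflt 0 (sigma.[? i])%fmap).
Proof.
move=> l0 [dom win sep].
(* [sigma] has the domain of the instance, so the default [0] is not taken below [size ws]. *)
have sigmaE i : (i < size ws)%N ->
    (sigma.[? i] = Some (odflt 0 sigma.[? i]))%fmap.
  by rewrite -mem_current_requests -dom -fndSome; case: fnd.
split=> [i w wi|i j iws jws ij].
  have iws : (i < size ws)%N by rewrite -onthTE wi.
  apply/interval_at_subset; first exact: ltW.
  by apply: win (sigmaE _ iws); rewrite current_requests.
by apply/not_overlapE => //; exact: sep ij (sigmaE _ iws) (sigmaE _ jws).
Qed.

(** * Length occupied by slots inside an interval *)

Definition clamp {R : realType} (a b x : R) : R := Num.max a (Num.min b x).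

Lemma clamp_id {R : realType} (a b x : R) : a <= x -> x <= b -> clamp a b x = x.
Proof. by move=> ax xb; rewrite /clamp (min_idPr xb) (max_idPr ax). Qed.

Lemma clamp_lo {R : realType} (a b x : R) : x <= a -> clamp a b x = a.
Proof. by move=> xa; apply/max_idPl; rewrite ge_min xa orbT. Qed.

Lemma clamp_hi {R : realType} (a b x : R) : a <= b -> b <= x -> clamp a b x = b.
Proof. by move=> ab bx; rewrite /clamp (min_idPl bx) (max_idPr ab). Qed.

(* For [a <= b], the length of the intersection of [x, x + 1] and [a, b]. *)
Definition occupied {R : realType} (a b x : R) : R :=
  clamp a b (x + 1) - clamp a b x.

Lemma occupied_split {R : realType} (a b c x : R) : a <= c -> c <= b ->
  occupied a b x = occupied a c x + occupied c b x.
Proof.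
(* On either side of [c], one clamp on the right is [c] and the other agrees with [clamp a b z]; the
   constant cancels in the difference. *)
move=> ac cb; suff E z : clamp a b z = clamp a c z + clamp c b z - c.
  by rewrite /occupied !E; ring.
have [zc|/ltW cz] := leP z c.
  by rewrite (clamp_lo _ _ _ zc) addrK /clamp !(min_idPr _) // (le_trans zc).
rewrite (clamp_hi _ _ _ ac cz) addrC addKr /clamp.
by rewrite !(max_idPr _) // le_min ?cb ?cz ?(le_trans ac).
Qed.

Lemma occupied_inside {R : realType} (a b x : R) : a <= x -> x + 1 <= b ->
  occupied a b x = 1.
Proof. by move=> ax xb; rewrite /occupied !clamp_id; lra. Qed.

(** The slot of [x] covers [[a, b]] and leaves no room for that of [y]. Covering is asked only for
    [a < b], since the piece cut out in [sum_occupied_le] may be a point outside the slot. *)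
Lemma occupied_separated {R : realType} (a b x y : R) : a <= b ->
  (a < b -> x <= a /\ b <= x + 1) -> separated 1 x y -> occupied a b y = 0.
Proof.
rewrite le_eqVlt => /orP[/eqP-> _ _|ab /(_ ab)[xa bx]].
  by rewrite /occupied /clamp !(max_idPl _) ?subrr // ge_min lexx.
rewrite /occupied => /orP[xy|yx]; last by rewrite !clamp_lo ?subrr //; lra.
by rewrite !clamp_hi ?subrr //; lra.
Qed.

Lemma sum_occupied_le {R : realType} (s : seq R) (a b : R) : a <= b ->
  pairwise (separated 1) s -> \sum_(x <- s) occupied a b x <= b - a.
Proof.
(* Removing the slot of [x] cuts [a, b] into [a, p] and [q, b]. *)
elim: s a b => [|x s IH] a b ab /=; first by rewrite big_nil; lra.
case/andP=> /allP xs /IH{}IH; rewrite big_cons {1}/occupied.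
set p := clamp a b x; set q := clamp a b (x + 1).
have [ap pq qb] : [/\ a <= p, p <= q & q <= b].
  rewrite /p /q /clamp !le_max !ge_max !le_min !ge_min !lexx ab /=.
  split=> //; have [xa|/ltW ax] := leP x a; rewrite ?orbT //.
  by rewrite lerDl ler01 (le_trans ax) ?orbT // lerDl.
have inx : p < q -> x <= p /\ q <= x + 1.
  rewrite /p /q; have [bx|/ltW xb] := leP b x.
    have bx1 : b <= x + 1 by lra.
    by rewrite !clamp_hi // ltxx.
  have [xa|/ltW ax] := leP (x + 1) a.
    have xa' : x <= a by lra.
    by rewrite !clamp_lo // ltxx.
  rewrite /clamp (min_idPr xb) le_max lexx orbT => _; split=> //.
  by rewrite ge_max ax ge_min lexx orbT.
(* The other slots occupy nothing of [[p, q]], hence by induction at most [(p - a) + (b - q)] in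
   total. *)
have -> : \sum_(y <- s) occupied a b y =
    \sum_(y <- s) (occupied a p y + occupied q b y); last first.
  by rewrite big_split /=; move: (IH _ _ ap) (IH _ _ qb); lra.
apply: eq_big_seq => y /xs xy; rewrite (occupied_split a b p) ?(le_trans pq) //.
by rewrite (occupied_split p b q) // (occupied_separated p q x) // add0r.
Qed.

Lemma sum_occupied_fits_le {R : realType} (ws : seq (window R)) pos (a b : R) :
  a <= b -> fits 1 ws pos ->
  \sum_(0 <= i < size ws) occupied a b (pos i) <= b - a.
Proof.
move=> ab [_ sep]; rewrite -(big_map pos predT (occupied a b)).
apply: sum_occupied_le => //; rewrite pairwise_map.
apply/(pairwiseP 0%N) => i j; rewrite !inE size_iota subn0 => iws jws ij.
rewrite !nth_iota ?subn0 //=; apply: sep => // e.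
by move: ij; rewrite -(add0n i) e add0n ltnn.
Qed.

(** * Extending the packing by intervals of length [g] *)

Lemma mulr_nat_step {R : realType} (g : R) k n : 0 <= g -> (k < n)%N ->
  g * k%:R + g <= g * n%:R.
Proof.
by move=> g0 kn; rewrite -{2}[g]mulr1 -mulrDr ler_wpM2l // natr1 ler_nat.
Qed.

(** The new tasks fill the stretch from [a] to [a + g * n] with consecutive cells of length [g]; the
    last hypothesis keeps the old intervals off it. *)
Lemma fits_cat_nseq {R : realType} (g a : R) (w : window R) n ws pos :
  0 <= g -> win_lo w <= a -> a + g * n%:R <= win_hi w -> fits g ws pos ->
  (forall i, (i < size ws)%N -> pos i + g <= a \/ a + g * n%:R <= pos i) ->
  fits g (ws ++ nseq n w)
    (fun i => if (i < size ws)%N then pos i else a + g * (i - size ws)%:R).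
Proof.
move=> g0 lo hi [win sep] out.
have cell k : (k < n)%N -> 0 <= g * k%:R /\ g * k%:R + g <= g * n%:R.
  by move=> kn; rewrite mulr_ge0 ?mulr_nat_step.
have sep' i j : (i < size ws)%N -> (j < n)%N ->
    separated g (pos i) (a + g * j%:R).
  by move=> /out + /cell; rewrite /separated; lra.
split=> [i v|i j].
  rewrite onth_cat; case: ltnP => [_ /win //|iws].
  rewrite onth_nseq; case: ltnP => // /cell + [<-]; lra.
rewrite size_cat size_nseq => iws jws ij.
case: ltnP => i1; case: ltnP => j1; first exact: sep.
- by apply: sep' => //; lia.
- by rewrite separatedC; apply: sep' => //; lia.
rewrite /separated.
have [lt|lt|//] := ltngtP i j; apply/orP; [left|right];
  by rewrite -addrA lerD2l mulr_nat_step //; lia.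
Qed.

(** * The allocator against the halving adversary *)

Definition slot {R : realType} (A : seq (request R) -> assignment R) ws i : R :=
  odflt 0 ((A (requests ws)).[? i])%fmap.

(** Insertion [n], counted from 0, changes the slot of an earlier task [i]. This is a true
    reallocation once both prefixes are known to have solutions. *)
Definition moves {R : realType} (A : seq (request R) -> assignment R) ws :
    Prop :=
  exists n i, [/\ (n < size ws)%N, (i < n)%N
    & slot A (take n ws) i <> slot A (take n.+1 ws) i].

Lemma slot_solution {R : realType} (A : seq (request R) -> assignment R)
    ws pos :
  allocator A -> (0 < size ws)%N -> fits 1 ws pos ->
  solution (current (requests ws)) (A (requests ws)).
Proof.
case/lastP: ws => // ws w hA _ f; rewrite requests_rcons.
apply: hA; rewrite -requests_rcons; first exact: legal_requests.
exact: fits_packing f.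
Qed.

Lemma slot_fits {R : realType} (A : seq (request R) -> assignment R) ws pos :
  allocator A -> fits 1 ws pos -> fits 1 ws (slot A ws).
Proof.
move=> hA f; case: (posnP (size ws)) => [/size0nil ->|ws0].
  by split=> // i w; rewrite onth0n.
exact: packing_fits ltr01 (slot_solution A ws pos hA ws0 f).
Qed.

Lemma moves_catl {R : realType} (A : seq (request R) -> assignment R) ws1 ws2 :
  moves A ws1 -> moves A (ws1 ++ ws2).
Proof.
move=> [n [i [nws i_n ne]]]; exists n, i.
by rewrite size_cat ltn_addr // !takel_cat // ltnW.
Qed.

Lemma not_moves_slot {R : realType} (A : seq (request R) -> assignment R)
    ws1 ws2 i :
  ~ moves A (ws1 ++ ws2) -> (i < size ws1)%N ->
  slot A (ws1 ++ ws2) i = slot A ws1 i.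
Proof.
elim/last_ind: ws2 => [|ws2 w IH]; first by rewrite cats0.
rewrite -rcons_cat => nm iws; rewrite -IH //; last first.
  by move=> m; apply: nm; rewrite -cats1; exact: moves_catl.
apply: contrapT => ne; apply: nm; exists (size (ws1 ++ ws2)), i.
rewrite size_rcons ltnSn size_cat ltn_addr //; split=> //.
rewrite -size_cat [take _.+1 _]take_oversize ?size_rcons // -cats1.
rewrite take_size_cat // cats1.
by move=> /esym.
Qed.

(** Without moves the old slots stay where they were, and each new slot lies inside [w],
    contributing exactly 1. *)
Lemma sum_occupied_cat_nseq {R : realType}
    (A : seq (request R) -> assignment R) ws pos n (w : window R) :
  allocator A -> fits 1 (ws ++ nseq n w) pos -> ~ moves A (ws ++ nseq n w) ->
  \sum_(0 <= i < size (ws ++ nseq n w))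
      occupied (win_lo w) (win_hi w) (slot A (ws ++ nseq n w) i) =
  \sum_(0 <= i < size ws) occupied (win_lo w) (win_hi w) (slot A ws i) + n%:R.
Proof.
move=> hA f nm; have [win _] := slot_fits A _ _ hA f.
rewrite size_cat size_nseq (@big_cat_nat _ _ _ (size ws)) ?leq_addr //=.
congr (_ + _).
  by apply: eq_big_nat => i /andP[_ iws]; rewrite not_moves_slot.
rewrite (eq_big_nat _ _ (F2 := fun=> 1)).
  by rewrite sumr_const_nat addKn.
move=> i /andP[wsi iw]; have [lo hi] : win_lo w <= slot A (ws ++ nseq n w) i /\
    slot A (ws ++ nseq n w) i + 1 <= win_hi w.
  apply: win; rewrite onth_cat ltnNge wsi /= onth_nseq ifT //; lia.
exact: occupied_inside.
Qed.

(* The lower bound [b k] on the occupied length solves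
   [b 0 = g - 1 / 2] and [b k = (b k.+1 + 2 ^ k) / 2], as [2 ^ k] slots are
   added before halving. It vanishes for [k = 2 * g - 1]. *)
Lemma forced_move {R : realType} (A : seq (request R) -> assignment R)
    (g : R) k ws pos (a : R) :
  allocator A -> 1 <= g -> fits g ws pos ->
  (forall i, (i < size ws)%N ->
     pos i + g <= a \/ a + g * (2 ^ k)%:R <= pos i) ->
  (2 ^ k)%:R * (g - 2^-1 - k%:R / 2) <=
    \sum_(0 <= i < size ws) occupied a (a + g * (2 ^ k)%:R) (slot A ws i) ->
  exists ws' pos', [/\ size ws' = (2 ^ k)%N, fits g (ws ++ ws') pos'
    & moves A (ws ++ ws')].
Proof.
move=> hA g1; have g0 : 0 <= g by lra.
elim: k ws pos a => [|k IH] ws pos a f out full.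
  have le : a <= a + g * (2 ^ 0)%:R by rewrite lerDl mulr_ge0.
  set w := Window le.
  have f' := fits_cat_nseq _ _ w (2 ^ 0) _ _ g0 (lexx _) (lexx _) f out.
  exists (nseq (2 ^ 0) w); eexists; split; [by rewrite size_nseq|exact: f'|].
  (* Without a move, a window of length [g] would be occupied up to at least [(g - 1 / 2) + 1]. *)
  apply: contrapT => nm; have f1 := fits_le _ _ _ _ g1 f'.
  have := sum_occupied_fits_le _ _ _ _ le (slot_fits _ _ _ hA f1).
  rewrite (sum_occupied_cat_nseq _ _ _ _ w hA f1 nm) /=.
  move: full; rewrite expn0; lra.
set n := (2 ^ k)%N in IH *; have En : (2 ^ k.+1)%:R = n%:R + n%:R :> R.
  by rewrite expnS mul2n -addnn natrD.
have n0 : 0 <= n%:R :> R by [].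
have gn0 : 0 <= g * n%:R by rewrite mulr_ge0.
have le : a <= a + g * (2 ^ k.+1)%:R by rewrite lerDl mulr_ge0.
set b := a + _ in le out full *; set w := Window le.
pose c := a + g * n%:R; have Eb : b = c + g * n%:R by rewrite /b En /c; ring.
have [ac cb] : a <= c /\ c <= b by rewrite Eb !lerDl.
(* Whichever half [a'] starts, [a + c - a'] starts the other one. *)
have fits_half a' : (a' = a \/ a' = c) -> fits g (ws ++ nseq n w)
    (fun i => if (i < size ws)%N then pos i
              else a + c - a' + g * (i - size ws)%:R).
  move=> ea'; apply: fits_cat_nseq => //=.
  - by case: ea' => ->; rewrite /c; lra.
  - by rewrite Eb; case: ea' => ->; rewrite /c; lra.
  by move=> i /out; rewrite Eb /c; case: ea' => ->; rewrite /c; lra.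
(* If these [n] tasks already force a move, [n] more copies of [w] bring the count to [2 ^ k.+1];
   the free window holds them all. *)
have [m|nm] := pselect (moves A (ws ++ nseq n w)).
  have f' := fits_cat_nseq _ _ w (2 ^ k.+1) _ _ g0 (lexx _) (lexx _) f out.
  exists (nseq (2 ^ k.+1) w); eexists; split; [by rewrite size_nseq|exact: f'|].
  by rewrite expnS mul2n -addnn nseqD catA; apply: moves_catl.
(* The whole window is now occupied up to [2 * n * (g - 1 / 2 - k.+1 / 2) + n], which is
   [2 * n * (g - 1 / 2 - k / 2)], or more; one half carries at least half of this. *)
have [a' [ea' full']] : exists a', (a' = a \/ a' = c) /\
    n%:R * (g - 2^-1 - k%:R / 2) <= \sum_(0 <= i < size (ws ++ nseq n w))
      occupied a' (a' + g * n%:R) (slot A (ws ++ nseq n w) i).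
  have f1 := fits_le _ _ _ _ g1 (fits_half a (or_introl erefl)).
  have := sum_occupied_cat_nseq _ _ _ _ w hA f1 nm.
  rewrite /= (eq_bigr _ (fun i _ => occupied_split a b c _ ac cb)).
  rewrite big_split /= => e.
  move: full; rewrite En -(natr1 k) => full.
  have [h|h] := leP (n%:R * (g - 2^-1 - k%:R / 2))
    (\sum_(0 <= i < size (ws ++ nseq n w))
        occupied a c (slot A (ws ++ nseq n w) i)).
    by exists a; split; [left|].
  exists c; split; [by right|]; rewrite -Eb; lra.
(* The packing puts the new tasks in the other half, so the half at [a'] stays free for the later
   rounds. *)
have [|ws' [pos' [sz f' m]]] := IH _ _ a' (fits_half a' ea') _ full'.
  move=> i; rewrite size_cat size_nseq => iws; case: ltnP => wsi.
    by have := out i wsi; rewrite Eb /c; case: ea' => ->; rewrite /c; lra.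
  have kn : (i - size ws < n)%N by rewrite ltn_subLR.
  have := mulr_nat_step g _ _ g0 kn.
  have : 0 <= g * (i - size ws)%:R by rewrite mulr_ge0.
  by case: ea' => ->; rewrite /c; lra.
exists (nseq n w ++ ws'), pos'; rewrite catA; split=> //.
by rewrite size_cat size_nseq sz addnn -mul2n -expnS.
Qed.

Theorem mainTheorem9 (R : realType) (A : seq (request R) -> assignment R)
    (hA : allocator A) (gamma : nat) (hgamma : (0 < gamma)%N) :
  exists s : seq (request R),
    [/\ size s = (2 ^ (2 * gamma - 1))%N,
        all (@is_insertion R) s,
        legal s,
        (forall k : nat, (0 < k <= size s)%N ->
           underallocated (gamma%:R : R) (current (take k s)))
      & exists (h1 h2 : seq (request R)) (q : request R) (i : nat),
          s = h1 ++ q :: h2 /\ reallocates A h1 q i].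
Proof.
have g1 : 1 <= gamma%:R :> R by rewrite ler1n.
have f0 : fits (gamma%:R : R) [::] (fun=> 0) by split=> // i w; rewrite onth0n.
have [//||ws [pos [sz f [n [i [nws i_n ne]]]]]] :=
  forced_move A gamma%:R (2 * gamma - 1) [::] (fun=> 0) 0 hA g1 f0.
  (* The required occupancy is 0, which the empty system meets. *)
  rewrite big_geq // natrB ?muln_gt0 // natrM.
  by rewrite [X in _ * X](_ : _ = 0) ?mulr0 //; lra.
rewrite /= in sz f nws ne.
exists (requests ws); split.
- by rewrite size_requests.
- exact: all_insertion_requests.
- exact: legal_requests.
- move=> k _; rewrite take_requests; apply: fits_packing; first by lra.
  exact: fits_take f.
have f1 := fits_le _ _ _ _ g1 f.
(* Every prefix containing task [i] has a solution, so the allocator gives [i] a slot and [ne] does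
   not come from default values. *)
have sol m : (i < m <= size ws)%N ->
    ((A (requests (take m ws))).[? i])%fmap = Some (slot A (take m ws) i).
  move=> /andP[im mws].
  have sm : size (take m ws) = m by rewrite size_takel.
  have [|dom _ _] :=
    slot_solution A (take m ws) pos hA _ (fits_take _ _ _ _ f1).
    by rewrite sm (leq_ltn_trans _ im).
  have : i \in domf (A (requests (take m ws))).
    by rewrite dom mem_current_requests sm.
  by rewrite /slot -fndSome; case: fnd.
have [w e] : exists w, requests (take n.+1 ws) =
    rcons (requests (take n ws)) (Insert n w).
  case: (ws) nws => // w0 ws' nws; exists (nth w0 (w0 :: ws') n).
  by rewrite (take_nth w0) // requests_rcons size_takel // ltnW.
exists (requests (take n ws)), (drop n.+1 (requests ws)), (Insert n w), i.
split; first by rewrite -cat_rcons -e -take_requests cat_take_drop.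
have sn : size (take n ws) = n by rewrite size_takel // ltnW.
have sn1 : size (take n.+1 ws) = n.+1 by rewrite size_takel.
split; rewrite -?e ?mem_current_requests ?sn ?sn1 ?ltnS ?(ltnW i_n) //.
exists (slot A (take n ws) i), (slot A (take n.+1 ws) i).
split; [apply: sol|apply: sol|exact: ne].
- by rewrite i_n ltnW.
- by rewrite ltnS (ltnW i_n).
Qed.
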